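(* Let $\sigma:\mathbb{P}(V)\dashrightarrow\mathbb{P}(W)$ be a normal quadratic congruence, where $C(\sigma)$ is a quadric of a hyperplane of $\mathbb{P}(V)=\mathbb{P}_{n-1}$ and $W\subset S^2V^*$ is the $(n+1)$-dimensional space of equations of quadrics of $\mathbb{P}(V)$ containing $C(\sigma)$. Let $\phi=(\sigma^* )^{-1}:W\to W^*$ be the associated isomorphism, assumed not antisymmetric, and let $r$ be the rank of the quadric $Q(\phi)$. Then the rank of $C(\sigma)$ is $r-2$, the symmetric part $(\phi^{-1})_S$ of $\phi^{-1}$ depends, up to a nonzero scalar factor, only on $W$, and $\sigma$ induces a birational isomorphism $\mathbb{P}(V)\simeq\overline{\sigma(\mathbb{P}(V))}$.
   Context: Let $n\ge 3$, let $V$ be a complex vector space of dimension $n$, and let $\mathbb{P}(V)=\mathbb{P}_{n-1}$ be the projective space of lines of $V$, so $H^0(\mathbb{P}(V),\mathcal{O}(2))=S^2V^*$; points of $\mathbb{P}(S^2V^* )$ are viewed as quadrics of $\mathbb{P}(V)$. Let $W\subset S^2V^*$ be a linear subspace of dimension $n+1$. A quadratic congruence with values in $\mathbb{P}(W)$ is a rational map $\sigma:\mathbb{P}(V)\dashrightarrow\mathbb{P}(W)$ such that: (1) $\sigma^*(\mathcal{O}(1))=\mathcal{O}(2)$; (2) $\sigma^*:W^*\to S^2V^*$ induces an isomorphism $W^*\simeq W$, also denoted $\sigma^*$ (it is determined by $\sigma$ up to a nonzero scalar); (3) for every point $P$ where $\sigma$ is defined, $P\in\sigma(P)$, where $\sigma(P)$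 is viewed as a quadric of $\mathbb{P}(V)$. It is called normal if $W$ is the space of equations of all quadrics of $\mathbb{P}(V)$ containing some quadric $C$ of a hyperplane $H$ of $\mathbb{P}(V)$; one then writes $C(\sigma)=C$ and $H(\sigma)=H$. The symmetric part of an isomorphism $\phi:W\to W^*$ (or $W^*\to W$) is $\phi_S=\frac12(\phi+{}^t\phi)$. If $\phi$ is not antisymmetric, $Q(\phi)\subset\mathbb{P}(W)$ denotes the quadric of equation $x.\phi(x)=0$, of rank $\mathrm{rk}(\phi_S)$. The rank of $C$ is the rank of a quadratic form on $H$ defining it. *)

(* Defs.v *)
From HB Require Import structures.
From mathcomp Require Import all_boot all_order all_algebra.
From mathcomp Require Import reals complex mpoly.

Set Implicit Arguments.
Unset Strict Implicit.
Unset Printing Implicit Defensive.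

Import GRing.Theory.
Local Open Scope ring_scope.

Notation dual U := 'Hom(U, GRing.regular _).

Definition ev (K : numClosedFieldType) (U : vectType K) :
    'Hom(U, dual (dual U)) :=
  linfun (fun u : U => linfun (fun l : dual U => l u)).

Definition dual_map (K : numClosedFieldType) (U T : vectType K)
    (f : 'Hom(U, T)) : 'Hom(dual T, dual U) :=
  linfun (fun l : dual T => (l \o f)%VF).

(* Transpose and symmetric part, for maps E -> E^* and for maps E^* -> E; the  *)
(* canonical isomorphism [ev] identifies E with its bidual.                    *)
Definition transp (K : numClosedFieldType) (E : vectType K)
    (phi : 'Hom(E, dual E)) : 'Hom(E, dual E) :=
  (dual_map phi \o ev E)%VF.

Definition transp_dual (K : numClosedFieldType) (E : vectType K)
    (psi : 'Hom(dual E, E)) : 'Hom(dual E, E) :=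
  ((ev E)^-1 \o dual_map psi)%VF.

Definition sym_part (K : numClosedFieldType) (E : vectType K)
    (phi : 'Hom(E, dual E)) : 'Hom(E, dual E) :=
  2^-1 *: (phi + transp phi).

Definition sym_part_dual (K : numClosedFieldType) (E : vectType K)
    (psi : 'Hom(dual E, E)) : 'Hom(dual E, E) :=
  2^-1 *: (psi + transp_dual psi).

Definition antisymmetric_map (K : numClosedFieldType) (E : vectType K)
    (phi : 'Hom(E, dual E)) : Prop :=
  transp phi = - phi.

(* An element of S^2 U^* is encoded by its polar symmetric bilinear form [b],  *)
(* normalized so that the quadratic form is [x |-> b x x].                     *)
Notation bilin U := 'Hom(U, 'Hom(U, GRing.regular _)).

Definition is_symmetric (K : numClosedFieldType) (U : vectType K)
    (b : bilin U) : Prop :=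
  forall x y : U, b x y = b y x.

Definition quad (K : numClosedFieldType) (U : vectType K) (b : bilin U)
    (x : U) : K :=
  b x x.

Definition quad_rank (K : numClosedFieldType) (U : vectType K)
    (b : bilin U) : nat :=
  \dim (limg b).

(* The equation of Q(phi): the quadratic form x |-> phi x x, whose polar form  *)
(* is the symmetric part of phi.                                               *)
Definition Qform (K : numClosedFieldType) (E : vectType K)
    (phi : 'Hom(E, dual E)) : bilin E :=
  sym_part phi.

(* Homogeneous forms of degree d on U, without choosing a basis.  As K is      *)
(* infinite, forms may be identified with the functions they define.           *)
Definition homog_form (K : numClosedFieldType) (U : vectType K) (d : nat)
    (f : U -> K) : Prop :=
  exists (m : nat) (l : 'I_m -> dual U) (p : {mpoly K[m]}),
    p \is d.-homog /\ (forall u : U, f u = p.@[fun i => l i u]).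

Definition homog_map (K : numClosedFieldType) (U T : vectType K) (d : nat)
    (F : U -> T) : Prop :=
  forall l : dual T, homog_form d (fun u => l (F u)).

(* No common factor of positive degree; in particular F is not zero.           *)
Definition coprime_map (K : numClosedFieldType) (U T : vectType K)
    (F : U -> T) : Prop :=
  forall (e k : nat) (g : U -> K) (G : U -> T),
    homog_form e g -> homog_map k G -> (forall u, F u = g u *: G u) -> e = 0%N.

(* A rational map P(U) --> P(T) has a homogeneous representative without       *)
(* common factor, unique up to a nonzero scalar.  The pullback of O(1) is then *)
(* O(rdeg), the domain of definition is the complement of the zeros of the     *)
(* representative, and the line of u is sent to the line of its value at u.    *)
Record ratmap (K : numClosedFieldType) (U T : vectType K) := RatMap {
  rdeg : nat;
  rfun :> U -> T;
  rfun_homog : homog_map rdeg rfun;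
  rfun_coprime : coprime_map rfun }.

Record quadratic_congruence (K : numClosedFieldType) (V : vectType K)
    (W : {vspace bilin V}) (sigma : ratmap V (subvs_of W))
    (s : 'Hom(dual (subvs_of W), subvs_of W)) : Prop := QuadraticCongruence {
  qc_sym : forall b : bilin V, b \in W -> is_symmetric b;
  qc_dim : \dim W = (\dim {:V}).+1;
  qc_deg : rdeg sigma = 2%N;
  (* s is sigma^*: composing a linear form l on W with sigma gives the         *)
  (* quadratic form s l on V, an element of W.                                 *)
  qc_pullback : forall (l : dual (subvs_of W)) (x : V),
    quad (vsval (s l)) x = l (sigma x);
  qc_bij : bijective s;
  qc_incidence : forall x : V, sigma x != 0 -> quad (vsval (sigma x)) x = 0 }.

(* The quadric of P(V) with equation b contains, as a subscheme, the quadric   *)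
(* of P(H) with equation c.                                                    *)
Definition contains_quadric (K : numClosedFieldType) (V : vectType K)
    (H : {vspace V}) (c : bilin (subvs_of H)) (b : bilin V) : Prop :=
  exists k : K, forall x : subvs_of H, quad b (vsval x) = k * quad c x.

(* W is the space of equations of all quadrics containing the quadric C of     *)
(* equation c in the hyperplane P(H).                                          *)
Record normal_with (K : numClosedFieldType) (V : vectType K)
    (W : {vspace bilin V}) (H : {vspace V}) (c : bilin (subvs_of H)) : Prop :=
  NormalWith {
  nw_hyperplane : (\dim H).+1 = \dim {:V};
  nw_sym : is_symmetric c;
  nw_neq0 : c != 0;
  nw_mem : forall b : bilin V,
    b \in W <-> is_symmetric b /\ contains_quadric c b }.

(* Subsets of P(U) are given by predicates on the nonzero vectors of U.        *)
Definition proj_space (K : numClosedFieldType) (U : vectType K) (u : U) : Prop :=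
  u != 0.

Definition rat_image (K : numClosedFieldType) (U T : vectType K) (F : U -> T)
    (y : T) : Prop :=
  exists x : U, x != 0 /\ F x != 0 /\ <[y]>%VS = <[F x]>%VS.

Definition zariski_closure (K : numClosedFieldType) (T : vectType K)
    (S : T -> Prop) (y : T) : Prop :=
  y != 0 /\
  (forall (d : nat) (f : T -> K), homog_form d f ->
     (forall z, S z -> f z = 0) -> f y = 0).

(* The homogeneous map F defines a rational map from X to Y, where X and Y are *)
(* irreducible closed subvarieties of P(U) and P(T).                           *)
Definition rational_between (K : numClosedFieldType) (U T : vectType K)
    (X : U -> Prop) (Y : T -> Prop) (F : U -> T) : Prop :=
  [/\ exists d, homog_map d F,
      exists x, X x /\ F x != 0
    & forall x, X x -> F x != 0 -> Y (F x)].

(* The composite of F and G is defined and is the identity as a rational map   *)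
(* from X to itself.                                                           *)
Definition comp_is_id (K : numClosedFieldType) (U T : vectType K)
    (X : U -> Prop) (F : U -> T) (G : T -> U) : Prop :=
  (exists x, [/\ X x, F x != 0 & G (F x) != 0]) /\
  (forall x, X x -> F x != 0 -> G (F x) != 0 -> <[G (F x)]>%VS = <[x]>%VS).

Definition birational_between (K : numClosedFieldType) (U T : vectType K)
    (X : U -> Prop) (Y : T -> Prop) (F : U -> T) : Prop :=
  rational_between X Y F /\
  (exists G : T -> U,
     [/\ rational_between Y X G, comp_is_id X F G & comp_is_id Y G F]).

Lemma linfunE_linear (K : numClosedFieldType) (U T : vectType K) (f : U -> T) :
  linear f -> forall u, linfun f u = f u.
Proof.
move=> f_lin u; pose fL := GRing.isLinear.Build K U T _ f f_lin.
pose g : {linear U -> T} := HB.pack f fL.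
exact: (lfunE g).
Qed.

Lemma evE (K : numClosedFieldType) (U : vectType K) (u : U) (l : dual U) :
  ev U u l = l u.
Proof.
have lin1 (v : U) : linear (fun m : dual U => m v).
  by move=> a m1 m2; rewrite add_lfunE scale_lfunE.
rewrite linfunE_linear ?linfunE_linear // => a v w.
apply/lfunP => m; rewrite add_lfunE scale_lfunE !linfunE_linear //.
by rewrite linearP.
Qed.

Lemma dual_mapE (K : numClosedFieldType) (U T : vectType K) (f : 'Hom(U, T))
    (l : dual T) (u : U) :
  dual_map f l u = l (f u).
Proof.
rewrite linfunE_linear ?comp_lfunE // => a m1 m2.
by apply/lfunP => v; rewrite !(add_lfunE, scale_lfunE, comp_lfunE).
Qed.

Lemma transpE (K : numClosedFieldType) (E : vectType K)
    (phi : 'Hom(E, dual E)) (x y : E) :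
  transp phi x y = phi y x.
Proof. by rewrite comp_lfunE dual_mapE evE. Qed.

Lemma ev_inj (K : numClosedFieldType) (U : vectType K) : lker (ev U) == 0%VS.
Proof.
rewrite -subv0; apply/subvP => u; rewrite memv_ker memv0 => /eqP u0.
rewrite (coord_vbasis (memvf u)) big1 // => i _.
have /lfunP/(_ (linfun (coord (vbasis {:U}) i : U -> K^o))) := u0.
by rewrite evE zero_lfunE lfunE /= => ->; rewrite scale0r.
Qed.

Lemma ev_surj (K : numClosedFieldType) (U : vectType K) :
  limg (ev U) = fullv.
Proof.
apply/eqP; rewrite eqEdim subvf /= limg_dim_eq; last first.
  by rewrite (eqP (ev_inj U)) capv0.
rewrite !dimvf.
by change (dim U * 1 * 1 <= dim U)%N; rewrite !muln1.
Qed.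

Lemma transp_dualE (K : numClosedFieldType) (E : vectType K)
    (psi : 'Hom(dual E, E)) (l m : dual E) :
  m (transp_dual psi l) = l (psi m).
Proof.
rewrite -evE comp_lfunE limg_lfunVK ?ev_surj ?memvf //.
by rewrite dual_mapE.
Qed.

Lemma QformE (K : numClosedFieldType) (E : vectType K)
    (phi : 'Hom(E, dual E)) (x : E) :
  quad (Qform phi) x = phi x x.
Proof.
rewrite /quad /Qform /sym_part !scale_lfunE !add_lfunE transpE.
have K2 : (2 : K) != 0 by rewrite Num.Theory.pnatr_eq0.
move: (phi x x : K) => a; rewrite -[LHS]/(2^-1 * (a + a) : K).
by rewrite -mulr2n -[a *+ 2]mulr_natl mulKf.
Qed.

(* Main.v *)
(* Write W = K q + h V^*, where h is an equation of H and q extends C to V.  A *)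
(* point x of V gives the linear form nu(x) : w |-> w(x, x) on W, and sigma is *)
(* nu followed by the transpose of sigma^*.  Incidence says that the quadratic *)
(* form l |-> l (sigma^* l) vanishes on nu(V).  Restricting it to the lines    *)
(* t |-> u + t e, with u in H and h(e) = 1, shows that every quadratic form    *)
(* vanishing on nu(V) is a multiple of D(l) = l(q) h(z) - q(z), where z in V   *)
(* is the vector with m(z) = l(h m) for all m in V^*.  Hence the symmetric     *)
(* part of sigma^* is a multiple of D, whose rank is rk C + 2.  The linear map *)
(* l |-> z inverts nu up to the factor h, and the closure of the image of      *)
(* sigma lies in the quadric D = 0, on which it is an inverse of sigma.        *)

Require Import Defs.
From HB Require Import structures.
From mathcomp Require Import all_boot all_order all_algebra.
From mathcomp Require Import reals complex mpoly ring.
Set Implicit Arguments.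
Unset Strict Implicit.
Unset Printing Implicit Defensive.
Import GRing.Theory.
Local Open Scope ring_scope.

(** Everything follows from one rigidity statement: a quadratic form on the dual of W that vanishes
    on nu(V) is a multiple of D ([polar_multiple]). Since sigma is T composed with nu, where T is
    the transpose of [s] ([congruence_nuE]), incidence makes l |-> l (s l) such a form, so its polar
    form is k times [nf_polar] ([congruence_polar]). If k were 0, phi would be antisymmetric
    ([congruence_polar_neq0]). Two congruences with values in P(W) are thus compared with the same
    D, which gives uniqueness of the symmetric part up to a scalar.

    The isomorphism T carries D, up to a nonzero scalar, to the equation of Q(phi). As D is a
    hyperbolic plane in l(q) and h(z) minus C on the H-component of z, its rank is rk C + 2
    ([quad_rank_congruence]). Finally pi (nu x) = h(x) x, and nu (pi l) = h(pi l) l as soon as D(l)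
    = 0; transported by T, these two identities make a linear projection inverse to sigma
    ([congruence_birational]). *)

Lemma quartic_coef0 (K : numFieldType) (a b c d e : K) :
  (forall t : K, a + b * t + c * t ^+ 2 + d * t ^+ 3 + e * t ^+ 4 = 0) ->
  [/\ a = 0, b = 0, c = 0, d = 0 & e = 0].
Proof.
move=> P; have K2 : (2 : K) != 0 by rewrite Num.Theory.pnatr_eq0.
have K3 : (3 : K) != 0 by rewrite Num.Theory.pnatr_eq0.
pose F t := a + b * t + c * t ^+ 2 + d * t ^+ 3 + e * t ^+ 4.
(* Central differences at the nodes 0, 1, -1, 2, -2 recover the coefficients of a quartic. *)
have E0 : a = F 0 by rewrite /F; ring.
have E1 : b = (8 * (F 1 - F (-1)) - (F 2 - F (-2))) / 12 by rewrite /F; field.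
have E2 : c = (16 * (F 1 + F (-1)) - (F 2 + F (-2)) - 30 * F 0) / 24.
  by rewrite /F; field.
have E3 : d = ((F 2 - F (-2)) - 2 * (F 1 - F (-1))) / 12 by rewrite /F; field.
have E4 : e = ((F 2 + F (-2)) - 4 * (F 1 + F (-1)) + 6 * F 0) / 24.
  by rewrite /F; field.
have FE t : F t = 0 by exact: P.
by rewrite E0 E1 E2 E3 E4 !FE; split; ring.
Qed.

(** * Scalar-valued linear, bilinear and quadratic maps *)

Section Pairing.
Variables (K : numClosedFieldType) (U T : vectType K).
Implicit Types (b : 'Hom(U, dual T)) (l m : dual U).

Lemma dual_linE l (a : K) x y :
  (l (a *: x + y) : K) = a * (l x : K) + (l y : K).
Proof. by rewrite linearP. Qed.

Lemma dual_combE l m (a : K) x :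
  ((a *: l + m) x : K) = a * (l x : K) + (m x : K).
Proof. by rewrite add_lfunE scale_lfunE. Qed.

Lemma linfun_dualE (f : U -> K) :
  (forall (a : K) x y, f (a *: x + y) = a * f x + f y) ->
  forall x, (linfun (f : U -> GRing.regular K) x : K) = f x.
Proof. by move=> lf x; rewrite linfunE_linear // => a u v; apply: lf. Qed.

Definition bilin_of (g : U -> T -> K) : 'Hom(U, dual T) :=
  linfun (fun x => linfun (g x : T -> GRing.regular K)).

Lemma bilin_ofE (g : U -> T -> K) :
  (forall x (a : K) y z, g x (a *: y + z) = a * g x y + g x z) ->
  (forall x (a : K) y z, g (a *: y + z) x = a * g y x + g z x) ->
  forall x y, (bilin_of g x y : K) = g x y.
Proof.
move=> gr gl x y; rewrite linfunE_linear; last first.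
  move=> a u v; apply/lfunP => z; rewrite add_lfunE scale_lfunE.
  by rewrite !linfunE_linear ?gl // => c s t; apply: gr.
by rewrite linfunE_linear // => c s t; apply: gr.
Qed.

Lemma bilin_linl b (a : K) x y z :
  (b (a *: x + y) z : K) = a * (b x z : K) + (b y z : K).
Proof. by rewrite linearP add_lfunE scale_lfunE. Qed.

End Pairing.

Lemma bilin_linr (K : numClosedFieldType) (U T : vectType K)
    (b : 'Hom(U, dual T)) (a : K) x y z :
  (b z (a *: x + y) : K) = a * (b z x : K) + (b z y : K).
Proof. exact: dual_linE. Qed.

Lemma bilin_combE (K : numClosedFieldType) (U T : vectType K)
    (b b' : 'Hom(U, dual T)) (a : K) x y :
  ((a *: b + b') x y : K) = a * (b x y : K) + (b' x y : K).
Proof. by rewrite !add_lfunE !scale_lfunE. Qed.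

Section Bilinear.
Variables (K : numClosedFieldType) (U : vectType K).
Implicit Types (b : bilin U).

Lemma quad_lin b (a : K) x y : is_symmetric b ->
  quad b (a *: x + y) = a ^+ 2 * quad b x + 2 * a * (b x y : K) + quad b y.
Proof.
move=> sb; rewrite /quad !(bilin_linl, bilin_linr) (sb y x).
by move: (b x x : K) (b x y : K) (b y y : K) => A B D; ring.
Qed.

Lemma bilinZr b (a : K) x y : (b x (a *: y) : K) = a * (b x y : K).
Proof. by rewrite linearZ. Qed.

Lemma quadZ b (a : K) x : quad b (a *: x) = a ^+ 2 * quad b x.
Proof.
rewrite /quad bilinZr -[a *: x]addr0 bilin_linl linear0 zero_lfunE addr0.
by rewrite mulrA.
Qed.

Lemma polarization b x y : is_symmetric b ->
  (b x y : K) = 2^-1 * (quad b (x + y) - quad b x - quad b y).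
Proof.
move=> sb; have K2 : (2 : K) != 0 by rewrite Num.Theory.pnatr_eq0.
rewrite -[in quad b (_ + _)](scale1r x) quad_lin //.
by move: (b x y : K) (quad b x) (quad b y) => A B D; field.
Qed.

Lemma sym_quad_inj b b' : is_symmetric b -> is_symmetric b' ->
  (forall x, quad b x = quad b' x) -> b = b'.
Proof.
move=> sb sb' E; apply/lfunP => x; apply/lfunP => y.
by rewrite (polarization _ _ sb) (polarization _ _ sb') !E.
Qed.

Lemma dual_ext (u v : U) : (forall l : dual U, l u = l v) -> u = v.
Proof.
move=> E; have /lker0P ev_injU := ev_inj U; apply: ev_injU; apply/lfunP => l.
by rewrite !evE.
Qed.

Lemma homog_form1 (l : dual U) : homog_form 1 (fun u => l u).
Proof.
exists 1%N, (fun=> l), 'X_ord0; split=> [|u]; last by rewrite mevalXU.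
by rewrite dhomogX; apply/eqP; exact: mdeg1.
Qed.

(** Allows the equation of Q(phi) to be used as a test form in [zariski_closure]. *)
Lemma homog_form_quad b : homog_form 2 (quad b).
Proof.
pose e := vbasis (fullv : {vspace U}).
pose l i : dual U := linfun (coord e i : U -> GRing.regular K).
exists _, l, (\sum_(i < \dim {:U}) \sum_(j < \dim {:U})
  (b e`_j e`_i : K) *: ('X_i * 'X_j)); split.
  apply: rpred_sum => i _; apply: rpred_sum => j _; apply: rpredZ.
  rewrite -[2%N]/(1 + 1)%N; apply: dhomogM; rewrite dhomogX; apply/eqP;
    exact: mdeg1.
move=> u; rewrite raddf_sum /quad.
have Er v : (b v u : K) = \sum_(i < \dim {:U}) coord e i u * (b v e`_i : K).
  rewrite {1}(coord_vbasis (memvf u)) linear_sum; apply: eq_bigr => i _.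
  by rewrite linearZ.
have El v : (b u v : K) = \sum_(j < \dim {:U}) coord e j u * (b e`_j v : K).
  rewrite {1}(coord_vbasis (memvf u)) linear_sum sum_lfunE.
  by apply: eq_bigr => i _; rewrite linearZ scale_lfunE.
rewrite Er; apply: eq_bigr => i _; rewrite El mulr_sumr raddf_sum.
apply: eq_bigr => j _; rewrite /= mevalZ mevalM !mevalXU !lfunE /=.
by rewrite [RHS]mulrC mulrA.
Qed.

End Bilinear.

(** By polarization. Applied to the equation of the quadric, it supplies a vector u0 of H off C. *)
Lemma sym_neq0_quad (K : numClosedFieldType) (U : vectType K) (b : bilin U) :
  is_symmetric b -> b != 0 -> exists x, quad b x != 0.
Proof.
move=> sb /lfunPn[x /lfunPn[y]]; rewrite !zero_lfunE => bxy.
have [qx|] := eqVneq (quad b x) 0; last by exists x.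
have [qy|] := eqVneq (quad b y) 0; last by exists y.
exists (x + y); apply: contraNneq bxy => qxy.
by apply/eqP/(etrans (polarization x y sb)); rewrite qx qy qxy !subr0 mulr0.
Qed.

(** * Coordinates on V and on W adapted to the hyperplane *)

(** Any e outside H spans a complement; h is the coordinate along e and p the projection parallel to
    e. *)
Lemma hyperplane_split (K : numClosedFieldType) (V : vectType K)
    (H : {vspace V}) :
  (\dim H).+1 = \dim {:V} ->
  exists (h : dual V) (p : 'Hom(V, subvs_of H)) (e : V),
    [/\ forall x, x = vsval (p x) + (h x : K) *: e, (h e : K) = 1
      & forall u : subvs_of H, (h (vsval u) : K) = 0].
Proof.
move=> dimH.
have /subvPn[e _ eNH] : ~~ ({:V} <= H)%VS.
  by apply/negP => /dimvS; rewrite -dimH ltnn.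
have e0 : e != 0 by apply: contraNneq eNH => ->; exact: mem0v.
have HIe : (H :&: <[e]> = 0)%VS.
  apply/eqP; rewrite -subv0; apply/subvP => x /memv_capP[xH /vlineP[k xE]].
  rewrite memv0; have [k0|k0] := eqVneq k 0; first by rewrite xE k0 scale0r.
  by case/negP: eNH; rewrite -[e]scale1r -(mulVf k0) -scalerA -xE memvZ.
have eIH : (<[e]> :&: H = 0)%VS by rewrite capvC.
have HDe : (H + <[e]> = fullv)%VS.
  apply/eqP; rewrite eqEdim subvf dimv_disjoint_sum // dim_vline e0 addn1 dimH.
  by rewrite /=.
pose X := [tuple e].
pose h : dual V := linfun
  (coord X ord0 \o daddv_pi <[e]> H : V -> GRing.regular K).
have hE x : (h x : K) = coord X ord0 (daddv_pi <[e]> H x) by rewrite lfunE.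
pose p := (linfun (vsproj H) \o daddv_pi H <[e]>)%VF.
have hpi x : (h x : K) *: e = daddv_pi <[e]> H x.
  have Xx : daddv_pi <[e]> H x \in <<X>>%VS by rewrite span_seq1 memv_pi.
  by rewrite [RHS](coord_span Xx) big_ord1 hE.
have heq0 x : daddv_pi <[e]> H x = 0 -> (h x : K) = 0.
  move=> E; apply/eqP; move/eqP: (hpi x).
  by rewrite E scaler_eq0 (negPf e0) orbF.
have he : (h e : K) = 1.
  have /eqP : ((h e : K) - 1) *: e = 0.
    by rewrite scalerBl scale1r hpi (daddv_pi_id eIH) ?memv_line // subrr.
  by rewrite scaler_eq0 (negPf e0) orbF subr_eq0 => /eqP.
exists h, p, e; split=> // [x | u].
  rewrite hpi comp_lfunE lfunE /= vsprojK ?memv_pi //.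
  by rewrite daddv_pi_add // HDe memvf.
apply: heq0; have := daddv_pi_add HIe (w := vsval u).
rewrite HDe memvf daddv_pi_id ?subvsP // => /(_ isT) E.
by apply: (addrI (vsval u)); rewrite E addr0.
Qed.

Section SymmetricProduct.
Variables (K : numClosedFieldType) (V : vectType K).
Implicit Types l m : dual V.

Definition symprod l m : bilin V :=
  bilin_of (fun x y => 2^-1 * ((l x : K) * (m y : K) + (l y : K) * (m x : K))).

Lemma symprodE l m x y :
  (symprod l m x y : K) =
  2^-1 * ((l x : K) * (m y : K) + (l y : K) * (m x : K)).
Proof.
by rewrite bilin_ofE // => u a v w; rewrite !dual_linE; ring.
Qed.

Lemma symprod_sym l m : is_symmetric (symprod l m).
Proof. by move=> x y; rewrite !symprodE addrC. Qed.

Lemma quad_symprod l m x : quad (symprod l m) x = (l x : K) * (m x : K).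
Proof.
rewrite /quad symprodE.
have K2 : (2 : K) != 0 by rewrite Num.Theory.pnatr_eq0.
by move: (l x : K) (m x : K) => a b; field.
Qed.

Lemma symprod_linear l : linear (symprod l).
Proof.
move=> a m1 m2; apply/lfunP => x; apply/lfunP => y.
apply: etrans (symprodE _ _ _ _) _.
apply: etrans (esym (bilin_combE _ _ _ _ _)).
by rewrite !symprodE !dual_combE; ring.
Qed.

End SymmetricProduct.

(* Coordinates on W adapted to the decomposition W = K q + h V^*: [nf_iota] is *)
(* m |-> h m, and [nf_L], [nf_kappa] are the two coordinates of an element.    *)
Record normal_frame (K : numClosedFieldType) (V : vectType K)
    (W : {vspace bilin V}) (H : {vspace V}) (C : bilin (subvs_of H)) :=
  NormalFrame {
  nf_h : dual V;
  nf_proj : 'Hom(V, subvs_of H);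
  nf_e : V;
  nf_split : forall x, x = vsval (nf_proj x) + (nf_h x : K) *: nf_e;
  nf_h_e : (nf_h nf_e : K) = 1;
  nf_h_H : forall u : subvs_of H, (nf_h (vsval u) : K) = 0;
  nf_q : subvs_of W;
  nf_quad_q : forall x, quad (vsval nf_q) x = quad C (nf_proj x);
  nf_iota : 'Hom(dual V, subvs_of W);
  nf_quad_iota : forall m x,
    quad (vsval (nf_iota m)) x = (nf_h x : K) * (m x : K);
  nf_L : dual (subvs_of W);
  nf_kappa : 'Hom(subvs_of W, dual V);
  nf_L_q : (nf_L nf_q : K) = 1;
  nf_L_iota : forall m, (nf_L (nf_iota m) : K) = 0;
  nf_kappa_q : nf_kappa nf_q = 0;
  nf_kappa_iota : forall m, nf_kappa (nf_iota m) = m;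
  nf_decomp : forall w, w = (nf_L w : K) *: nf_q + nf_iota (nf_kappa w) }.

(** A form in W restricts to a multiple of C on H. Subtracting that multiple of q leaves a form
    vanishing on H, hence divisible by h. *)
Lemma normal_frame_exists (K : numClosedFieldType) (V : vectType K)
    (W : {vspace bilin V}) (H : {vspace V}) (C : bilin (subvs_of H)) :
  normal_with W C -> inhabited (normal_frame W C).
Proof.
move=> [dimH sC C0 memW].
have K2 : (2 : K) != 0 by rewrite Num.Theory.pnatr_eq0.
have [h [p [e [split_x he hH]]]] := hyperplane_split dimH.
have [u0 Cu0] := sym_neq0_quad sC C0.
have pH u : p (vsval u) = u.
  by apply/val_inj; rewrite /= [RHS]split_x hH scale0r addr0.
have pe : p e = 0.
  apply/val_inj; apply: (addIr e); rewrite -[val 0]/(vsval 0) linear0 add0r.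
  by rewrite [RHS]split_x he scale1r.
(* The extension of C to V with e in its kernel. *)
pose qb : bilin V := bilin_of (fun x y => C (p x) (p y) : K).
have qbE x y : (qb x y : K) = C (p x) (p y).
  rewrite /qb bilin_ofE // => u a v w; rewrite linearP.
    by rewrite bilin_linr.
  by rewrite bilin_linl.
have qbW : qb \in W.
  apply/memW; split; first by move=> x y; rewrite !qbE sC.
  by exists 1 => u; rewrite /quad qbE !pH mul1r.
have iW m : symprod h m \in W.
  apply/memW; split; first exact: symprod_sym.
  by exists 0 => u; rewrite quad_symprod hH !mul0r.
pose q := vsproj W qb.
pose iota : 'Hom(dual V, subvs_of W) :=
  linfun (fun m => vsproj W (symprod h m)).
have iotaE m : vsval (iota m) = symprod h m.
  rewrite linfunE_linear ?vsprojK // => a m1 m2.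
  by rewrite symprod_linear linearP.
have qE : vsval q = qb by rewrite vsprojK.
(* The ratio of w to C on H, read off at u0. *)
pose L : dual (subvs_of W) := linfun (fun w : subvs_of W =>
  (quad C u0)^-1 * quad (vsval w) (vsval u0) : GRing.regular K).
have LE w : (L w : K) = (quad C u0)^-1 * quad (vsval w) (vsval u0).
  apply: linfun_dualE => a w1 w2.
  by rewrite /quad linearP bilin_combE mulrDr mulrCA.
(* For w = a q + h m one has 2 w(e, z) = m(z) + h(z) m(e) and w(e, e) = m(e), which solves for
   m(z). *)
pose kz (w : subvs_of W) (z : V) : K :=
  2 * (vsval w e z : K) - (h z : K) * (vsval w e e : K).
pose kappa : 'Hom(subvs_of W, dual V) := bilin_of kz.
have kappaE w z : (kappa w z : K) = kz w z.
  rewrite bilin_ofE // => [w1|z1] a y1 y2; rewrite /kz.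
    by rewrite bilin_linr dual_linE; ring.
  by rewrite linearP !bilin_combE; ring.
have quad_w w x :
    quad (vsval w) x = (L w : K) * quad C (p x) + (h x : K) * kz w x.
  have /memW[sw [k wk]] := subvsP w.
  rewrite LE wk mulrCA mulVf // mulr1 /kz.
  have wex : (vsval w e x : K) =
      vsval w e (vsval (p x)) + (h x : K) * quad (vsval w) e.
    by rewrite {1}(split_x x) addrC bilin_linr addrC.
  rewrite wex {1}(split_x x) addrC quad_lin // wk /quad.
  by ring.
exists; apply: (@NormalFrame _ _ _ _ _ h p e split_x he hH q _ iota _ L kappa).
- by move=> x; rewrite /quad qE qbE.
- by move=> m x; rewrite iotaE quad_symprod.
- by rewrite LE /quad qE qbE pH mulVf.
- by move=> m; rewrite LE iotaE quad_symprod hH mul0r mulr0.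
- apply/lfunP => z; rewrite zero_lfunE; apply: etrans (kappaE _ _) _.
  by rewrite /kz qE !qbE pe linear0 !zero_lfunE !mulr0 subrr.
- move=> m; apply/lfunP => z; apply: etrans (kappaE _ _) _.
  rewrite /kz iotaE !symprodE he.
  by move: (m z : K) (m e : K) (h z : K) => *; field.
- move=> w; apply/val_inj; apply: (@sym_quad_inj _ _ (vsval w)).
  + by have /memW[] := subvsP w.
  + by have /memW[] := subvsP ((L w : K) *: q + iota (kappa w)).
  have wE : vsval ((L w : K) *: q + iota (kappa w)) =
      (L w : K) *: qb + symprod h (kappa w) by rewrite linearP /= iotaE qE.
  move=> x; rewrite quad_w -kappaE -[RHS]/(quad (vsval _) x) wE.
  by rewrite /quad bilin_combE qbE -[X in _ = _ + X]/(quad _ _) quad_symprod.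
Qed.

(** * Quadratic forms on the dual of W vanishing on nu(V) *)

Section Frame.
Variables (K : numClosedFieldType) (V : vectType K) (W : {vspace bilin V}).
Variables (H : {vspace V}) (C : bilin (subvs_of H)) (F : normal_frame W C).

Local Notation E := (subvs_of W).
Local Notation h := (nf_h F).
Local Notation p := (nf_proj F).
Local Notation e := (nf_e F).
Local Notation q := (nf_q F).
Local Notation L := (nf_L F).

Lemma nf_proj_H u : p (vsval u) = u.
Proof.
by apply/val_inj; rewrite /= [RHS](nf_split F) nf_h_H scale0r addr0.
Qed.

Lemma nf_proj_e : p e = 0.
Proof.
apply/val_inj; apply: (addIr e); rewrite -[val 0]/(vsval 0) linear0 add0r.
by rewrite [RHS](nf_split F) nf_h_e scale1r.
Qed.

(** [nf_M] and [nf_pi] are the transposes of [nf_kappa] and [nf_iota], with V identified to its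
    bidual; dually to the splitting of W, the dual of W is K L + M(V). *)
Definition nf_M : 'Hom(V, dual E) := (dual_map (nf_kappa F) \o ev V)%VF.
Definition nf_pi : 'Hom(dual E, V) := ((ev V)^-1 \o dual_map (nf_iota F))%VF.
Local Notation M := nf_M.
Local Notation pi := nf_pi.

Lemma nf_ME z w : (M z w : K) = nf_kappa F w z.
Proof. by rewrite comp_lfunE dual_mapE evE. Qed.

Lemma nf_piE (m : dual V) l : (m (pi l) : K) = l (nf_iota F m).
Proof.
by rewrite -[LHS]evE comp_lfunE limg_lfunVK ?ev_surj ?memvf // dual_mapE.
Qed.

Lemma nf_pi_M z : pi (M z) = z.
Proof.
apply/dual_ext => m; apply: etrans (nf_piE _ _) _.
by rewrite nf_ME nf_kappa_iota.
Qed.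

Lemma nf_pi_L : pi L = 0.
Proof.
apply/dual_ext => m; apply: etrans (nf_piE _ _) _.
by rewrite nf_L_iota linear0.
Qed.

Lemma nf_M_q z : (M z q : K) = 0.
Proof. by rewrite nf_ME nf_kappa_q zero_lfunE. Qed.

Lemma nf_dual_decomp (l : dual E) : l = (l q : K) *: L + M (pi l).
Proof.
apply/lfunP => w; apply/esym; apply: etrans (dual_combE _ _ _ _) _.
by rewrite nf_ME nf_piE [in RHS](nf_decomp F w) dual_linE mulrC.
Qed.

(** Evaluation of the forms of W at x, written in the splitting K L + M(V). *)
Definition nf_nu (x : V) : dual E := quad C (p x) *: L + (h x : K) *: M x.
Local Notation nu := nf_nu.

Lemma nf_nuE x w : (nu x w : K) = quad (vsval w) x.
Proof.
rewrite [in RHS](nf_decomp F w) linearP /quad bilin_combE.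
rewrite -[X in _ * X + _]/(quad _ _) -[X in _ = _ + X]/(quad _ _).
rewrite nf_quad_q nf_quad_iota dual_combE scale_lfunE.
by rewrite -[_ *: _ ]/(_ * (M x w : K)) nf_ME mulrC.
Qed.

Lemma nf_pi_nu x : pi (nu x) = (h x : K) *: x.
Proof. by rewrite linearP linearZ /= nf_pi_L nf_pi_M scaler0 add0r. Qed.

(* The polar form of 2 D. *)
Definition nf_polar (l m : dual E) : K :=
  (l q : K) * (h (pi m) : K) + (m q : K) * (h (pi l) : K)
  - 2 * (C (p (pi l)) (p (pi m)) : K).

Lemma polar_multiple (S : bilin (dual E)) :
  is_symmetric C -> C != 0 -> is_symmetric S ->
  (forall x, quad S (nu x) = 0) ->
  exists k : K, forall l m, (S l m : K) = k * nf_polar l m.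
Proof.
move=> sC C0 sS S0.
have K2 : (2 : K) != 0 by rewrite Num.Theory.pnatr_eq0.
have [u0 Cu0] := sym_neq0_quad sC C0.
pose Mu (u : subvs_of H) := M (vsval u).
pose beta u : K := S L (Mu u).
(* This is the only possible scalar, since [nf_polar] takes the value 1 at (L, M e). *)
pose k : K := S L (M e).
(* For u in H, nu (u + t e) = C(u) L + t M u + t^2 M e, so S gives a quartic in t whose five
   coefficients must vanish. *)
have coefs u : [/\ quad C u ^+ 2 * quad S L = 0, 2 * quad C u * beta u = 0,
    2 * quad C u * k + quad S (Mu u) = 0,
    2 * (S (Mu u) (M e) : K) = 0 & quad S (M e) = 0].
  apply: quartic_coef0 => t; have := S0 (vsval u + t *: e).
  have -> : nu (vsval u + t *: e) = quad C u *: L + t *: (t *: M e + Mu u).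
    rewrite /nu linearD linearZ /= nf_proj_H nf_proj_e scaler0 addr0.
    rewrite [h (_ + _)]linearD linearZ /= nf_h_H add0r nf_h_e.
    rewrite -[t *: 1]/(t * 1) mulr1 [M (_ + _)]linearD linearZ /=.
    by rewrite [X in t *: X]addrC.
  rewrite quad_lin // quadZ bilinZr bilin_linr quad_lin // (sS (M e)).
  rewrite -/(beta u) -/k => E0; rewrite -[RHS]E0.
  by move: (S (Mu u) (M e) : K) => a; ring.
have cancel0 (c a : K) : c != 0 -> c * a = 0 -> a = 0.
  by move=> c0 /eqP; rewrite mulf_eq0 (negPf c0) => /eqP.
have betaD u v (t : K) : beta (t *: v + u) = t * beta v + beta u.
  by rewrite /beta /Mu !linearP.
have SLL : quad S L = 0.
  by have [E0 _ _ _ _] := coefs u0; apply: cancel0 E0; rewrite expf_eq0.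
have SLMu u : beta u = 0.
  have b0 : beta u0 = 0.
    by have [_ E0 _ _ _] := coefs u0; apply: cancel0 E0; rewrite mulf_neq0.
  (* C times beta vanishes on all of H. As beta(u0) = 0, beta is constant along t u0 + u, and the
     coefficient of t^2 there isolates C(u0) beta(u). *)
  have [| _ _ + _ _] := @quartic_coef0 K (2 * quad C u * beta u)
      (4 * (C u0 u : K) * beta u) (2 * quad C u0 * beta u) 0 0.
    move=> t; have [_ E0 _ _ _] := coefs (t *: u0 + u).
    rewrite -[RHS]E0 betaD b0 quad_lin //.
    by move: (C u0 u : K) => a; ring.
  by apply: cancel0; rewrite mulf_neq0.
have SMuMe u : (S (Mu u) (M e) : K) = 0.
  by have [_ _ _ E0 _] := coefs u; apply: cancel0 E0.
have SMeMe : quad S (M e) = 0 by have [] := coefs u0.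
(* The t^2 coefficient ties S on M(H) to C; polarizing it determines the last block of S. *)
have SMuMv u v : (S (Mu u) (Mu v) : K) = - 2 * k * (C u v : K).
  have qM w : quad S (Mu w) = - 2 * k * quad C w.
    have [_ _ /eqP + _ _] := coefs w; rewrite addrC addr_eq0 => /eqP ->.
    ring.
  rewrite polarization // (polarization u v sC).
  have -> : Mu u + Mu v = Mu (u + v) by rewrite /Mu !linearD.
  by rewrite !qM; ring.
exists k => l m; rewrite [in LHS](nf_dual_decomp l) [in LHS](nf_dual_decomp m).
have Msplit z : M z = (h z : K) *: M e + Mu (p z).
  by rewrite {1}(nf_split F z) addrC linearP.
rewrite bilin_linl !bilin_linr (sS (M (pi l)) L) /nf_polar.
have SLM z : (S L (M z) : K) = (h z : K) * k.
  by rewrite Msplit bilin_linr -/(beta _) SLMu addr0.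
rewrite !SLM -[S L L]/(quad S L) SLL.
rewrite (Msplit (pi l)) (Msplit (pi m)) bilin_linl !bilin_linr.
rewrite (sS (M e) (Mu _)) !SMuMe SMuMv -[S (M e) (M e)]/(quad S (M e)) SMeMe.
move: (l q : K) (m q : K) (h (pi l) : K) (h (pi m) : K) => ? ? ? ?.
by move: (C _ _ : K) => ?; ring.
Qed.

End Frame.

(** * Inverses and transposes *)

Lemma bij_lfunK (K : fieldType) (U T : vectType K) (s : 'Hom(U, T)) :
  bijective s -> cancel s (s^-1)%VF /\ cancel (s^-1)%VF s.
Proof.
move=> [g gK Kg]; have s0 : lker s == 0%VS by apply/lker0P; exact: can_inj gK.
have sK := lker0_lfunK s0; split=> // w.
by rewrite -[w]Kg sK.
Qed.

Lemma lfun_invK (K : fieldType) (U T : vectType K) (s : 'Hom(U, T)) :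
  bijective s -> ((s^-1)^-1)%VF = s.
Proof.
move=> /bij_lfunK[sK Ks]; apply/lfunP => u.
have s0 : lker (s^-1)%VF == 0%VS by apply/lker0P; exact: can_inj Ks.
by rewrite -{1}[u]sK (lker0_lfunK s0).
Qed.

Lemma dim_subvs (K : fieldType) (U : vectType K) (X : {vspace U}) :
  \dim {:subvs_of X} = \dim X.
Proof. by rewrite dimvf. Qed.

Section Transpose.
Variables (K : numClosedFieldType) (E : vectType K).
Variables (s : 'Hom(dual E, E)) (s_bij : bijective s).

Local Notation phi := (s^-1)%VF.
Local Notation T := (transp_dual s).

Lemma transp_dual_invK : cancel T (transp phi).
Proof.
have [sK Ks] := bij_lfunK s_bij.
by move=> l; apply/lfunP => w; rewrite transpE transp_dualE Ks.
Qed.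

Lemma transp_invK : cancel (transp phi) T.
Proof.
have [sK Ks] := bij_lfunK s_bij.
by move=> w; apply/dual_ext => l; rewrite transp_dualE transpE sK.
Qed.

(** Through T, the form of phi on W becomes the form of [s] on the dual of W, where D lives. *)
Lemma inv_transp_dualE l m : phi (T l) (T m) = l (s m).
Proof.
have [sK Ks] := bij_lfunK s_bij.
by rewrite transp_dualE Ks transp_dualE.
Qed.

Lemma sym_part_dualE (l m : dual E) :
  (m (sym_part_dual s l) : K) = 2^-1 * ((l (s m) : K) + (m (s l) : K)).
Proof.
rewrite /sym_part_dual scale_lfunE add_lfunE linearZ linearD /= transp_dualE.
by rewrite addrC.
Qed.

Lemma Qform_transp_dualE (l m : dual E) :
  (Qform phi (T l) (T m) : K) = 2^-1 * ((l (s m) : K) + (m (s l) : K)).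
Proof.
by rewrite /Qform /sym_part !scale_lfunE !add_lfunE transpE !inv_transp_dualE.
Qed.

End Transpose.

Lemma vlineZ (K : fieldType) (U : vectType K) (a : K) (u : U) :
  a != 0 -> <[a *: u]>%VS = <[u]>%VS.
Proof.
move=> a0; apply: subv_anti; rewrite -!memvE; apply/andP; split.
  by rewrite memvZ // memv_line.
by rewrite -{1}[u]scale1r -(mulVf a0) -scalerA memvZ // memv_line.
Qed.

(** * Rank and birationality for a normal congruence *)

Section Congruence.
Variables (K : numClosedFieldType) (V : vectType K) (W : {vspace bilin V}).
Variables (H : {vspace V}) (C : bilin (subvs_of H)) (F : normal_frame W C).
Variables (normalW : normal_with W C).
Variables (sigma : ratmap V (subvs_of W)).
Variables (s : 'Hom(dual (subvs_of W), subvs_of W)).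
Variables (qc : quadratic_congruence sigma s).

Local Notation E := (subvs_of W).
Local Notation h := (nf_h F).
Local Notation p := (nf_proj F).
Local Notation e := (nf_e F).
Local Notation q := (nf_q F).
Local Notation L := (nf_L F).
Local Notation M := (nf_M F).
Local Notation pi := (nf_pi F).
Local Notation nu := (nf_nu F).
Local Notation phi := (s^-1)%VF.
Local Notation T := (transp_dual s).

Lemma congruence_nuE x : sigma x = T (nu x).
Proof.
apply/dual_ext => m; rewrite transp_dualE.
by apply/esym; apply: etrans (nf_nuE _ _ _) _; rewrite (qc_pullback qc).
Qed.

Lemma congruence_incidence x : (nu x (s (nu x)) : K) = 0.
Proof.
rewrite nf_nuE (qc_pullback qc) nf_nuE.
(* Incidence is assumed only where sigma is defined; at its zeros the form is zero. *)
have [->|] := eqVneq (sigma x) 0; last exact: (qc_incidence qc).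
by rewrite /quad linear0 !zero_lfunE.
Qed.

Lemma congruence_polar : exists k : K, forall l m : dual E,
  (l (s m) : K) + (m (s l) : K) = k * nf_polar F l m.
Proof.
pose S : bilin (dual E) :=
  bilin_of (fun l m : dual E => (l (s m) : K) + (m (s l) : K)).
have SE l m : (S l m : K) = (l (s m) : K) + (m (s l) : K).
  rewrite bilin_ofE // => l1 a m1 m2; rewrite linearP dual_linE dual_combE;
  by ring.
have [||| x |k kE] := @polar_multiple _ _ _ _ _ F S.
- exact: nw_sym normalW.
- exact: nw_neq0 normalW.
- by move=> l m; apply: etrans (SE _ _) _; rewrite addrC; apply/esym/SE.
- by apply: etrans (SE _ _) _; rewrite congruence_incidence addr0.
by exists k => l m; rewrite -kE SE.
Qed.

Lemma congruence_polar_neq0 (k : K) :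
  (forall l m : dual E, (l (s m) : K) + (m (s l) : K) = k * nf_polar F l m) ->
  ~ antisymmetric_map phi -> k != 0.
Proof.
move=> kE nanti; apply/eqP => k0; apply: nanti.
apply/lfunP => x; apply/lfunP => y.
rewrite transpE !opp_lfunE.
rewrite -[x](transp_invK (qc_bij qc)) -[y](transp_invK (qc_bij qc)).
rewrite !(inv_transp_dualE (qc_bij qc)).
set l := transp phi x; set m := transp phi y.
have := kE m l; rewrite k0 mul0r => /eqP; rewrite addr_eq0 => /eqP.
exact.
Qed.

(** Pairing with L, with M e and with M v for v in H reads off the kernel of D. *)
Lemma nf_polar_L (l : dual E) : nf_polar F l L = h (pi l).
Proof.
by rewrite /nf_polar nf_pi_L nf_L_q !linear0 !mulr0 mul1r add0r subr0.
Qed.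

Lemma nf_polar_M (l : dual E) x : nf_polar F l (M x) =
  (l q : K) * (h x : K) - 2 * (C (p (pi l)) (p x) : K).
Proof. by rewrite /nf_polar nf_pi_M nf_M_q mul0r addr0. Qed.

Lemma quad_rank_congruence :
  ~ antisymmetric_map phi -> quad_rank (Qform phi) = (quad_rank C + 2)%N.
Proof.
move=> nanti; have [k kE] := congruence_polar.
have k0 := congruence_polar_neq0 kE nanti.
have K2 : (2 : K) != 0 by rewrite Num.Theory.pnatr_eq0.
have TK := transp_dual_invK (qc_bij qc); have KT := transp_invK (qc_bij qc).
have QE l m : (Qform phi (T l) (T m) : K) = 2^-1 * (k * nf_polar F l m).
  by rewrite (Qform_transp_dualE (qc_bij qc)) kE.
pose J : 'Hom(subvs_of H, E) := (T \o (M \o linfun vsval))%VF.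
have JE u : J u = T (M (vsval u)).
  by apply: etrans (comp_lfunE _ _ _) _; rewrite (comp_lfunE M) (lfunE vsval).
have J0 : lker J == 0%VS.
  apply/lker0P => u v; rewrite !JE => /(can_inj TK)/(congr1 pi).
  by rewrite !nf_pi_M => /val_inj.
(* The hyperbolic plane contributes nothing to the kernel, which therefore is the image of the
   kernel of C under the injection J. *)
have kerQ : lker (Qform phi) = (J @: lker C)%VS.
  apply/vspaceP => w; rewrite memv_ker; apply/eqP/memv_imgP => [Qw | [u + ->]].
    set l := transp phi w.
    have Dl m : nf_polar F l m = 0.
      have := QE l m; rewrite KT Qw zero_lfunE => /esym/eqP.
      by rewrite !mulf_eq0 invr_eq0 (negPf K2) (negPf k0) => /eqP.
    have hl : (h (pi l) : K) = 0 by rewrite -nf_polar_L Dl.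
    have lq : (l q : K) = 0.
      have := Dl (M e); rewrite nf_polar_M nf_h_e nf_proj_e linear0 mulr0 subr0.
      by rewrite mulr1.
    exists (p (pi l)).
      rewrite memv_ker; apply/eqP/lfunP => v; rewrite zero_lfunE.
      have := Dl (M (vsval v)); rewrite nf_polar_M lq mul0r sub0r nf_proj_H.
      by move/eqP; rewrite oppr_eq0 mulf_eq0 (negPf K2) => /eqP.
    rewrite JE -[w]KT -/l {1}(nf_dual_decomp F l) lq scale0r add0r.
    by rewrite {1}(nf_split F (pi l)) hl scale0r addr0.
  rewrite memv_ker => /eqP Cu; apply/lfunP => w1.
  rewrite zero_lfunE JE -[w1]KT; apply: etrans (QE _ _) _.
  rewrite /nf_polar nf_M_q nf_pi_M nf_h_H nf_proj_H Cu.
  by rewrite zero_lfunE mul0r !mulr0 addr0 subrr !mulr0.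
(* The kernels have equal dimension while dim W = dim H + 2, so the ranks differ by 2. *)
have dimQ := limg_ker_dim (Qform phi) fullv.
have dimC := limg_ker_dim C fullv.
rewrite capfv kerQ limg_dim_eq ?(eqP J0) ?capv0 // in dimQ.
rewrite capfv in dimC.
rewrite dim_subvs (qc_dim qc) -(nw_hyperplane normalW) in dimQ.
rewrite -(dim_subvs H) -dimC in dimQ.
by move/eqP: dimQ; rewrite -!addnS eqn_add2l => /eqP; rewrite addn2.
Qed.

Lemma congruence_birational : ~ antisymmetric_map phi ->
  birational_between (@proj_space _ V) (zariski_closure (rat_image sigma)) sigma.
Proof.
move=> nanti; have [k kE] := congruence_polar.
have k0 := congruence_polar_neq0 kE nanti.
have K2 : (2 : K) != 0 by rewrite Num.Theory.pnatr_eq0.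
have TK := transp_dual_invK (qc_bij qc); have KT := transp_invK (qc_bij qc).
(* [transp phi] inverts T, and pi inverts nu up to the factor h. *)
pose G : 'Hom(E, V) := (pi \o transp phi)%VF.
have Gsigma x : G (sigma x) = (h x : K) *: x.
  by rewrite comp_lfunE congruence_nuE TK nf_pi_nu.
have sigmaG y : zariski_closure (rat_image sigma) y ->
    sigma (G y) = (h (G y) : K) *: y.
  move=> [_ clY]; set l := transp phi y.
  have Gy : G y = pi l by rewrite comp_lfunE.
  have quadT m : quad phi (T m) = (m (s m) : K).
    exact: (inv_transp_dualE (qc_bij qc)).
  (* The equation of Q(phi) vanishes on the image of sigma, hence on its closure. *)
  have Q0 : quad phi y = 0.
    apply: clY (homog_form_quad phi) _ => z [x [_ [_ zx]]].
    have /vlineP[a ->] : z \in <[sigma x]>%VS by rewrite -zx memv_line.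
    by rewrite quadZ congruence_nuE quadT congruence_incidence mulr0.
  have D0 : nf_polar F l l = 0.
    have := kE l l; rewrite -quadT KT Q0 addr0 => /esym/eqP.
    by rewrite mulf_eq0 (negPf k0) => /eqP.
  have Cz : quad C (p (pi l)) = (l q : K) * (h (pi l) : K).
    have /eqP := D0; rewrite /nf_polar subr_eq0 => /eqP D1.
    by apply: (mulfI K2); rewrite /quad -D1; ring.
  (* With C(p z) = l(q) h(z), the factor h(z) comes out of nu(z) and leaves l(q) L + M z = l. *)
  rewrite Gy congruence_nuE -[y in RHS]KT -/l -linearZ; congr (T _).
  rewrite /nf_nu Cz; set z := pi l.
  by rewrite [in RHS](nf_dual_decomp F l) -/z scalerDr scalerA [in RHS]mulrC.
have e0 : e != 0.
  apply: contra_neq (oner_neq0 K) => e0.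
  by rewrite -(nf_h_e F) e0 linear0.
(* The point e, where h = 1, witnesses that both composites are defined somewhere. *)
have Gsigma_e : G (sigma e) = e by rewrite Gsigma nf_h_e scale1r.
have sigma_e0 : sigma e != 0.
  by apply: contra_neq e0 => E0; rewrite -Gsigma_e E0 linear0.
have img_closure x : x != 0 -> sigma x != 0 ->
    zariski_closure (rat_image sigma) (sigma x).
  by move=> x0 sx0; split=> // d f _; apply; exists x.
split.
  split; [by exists (rdeg sigma); exact: rfun_homog | by exists e |].
  by move=> x; exact: img_closure.
exists G; split.
- split=> //; last first.
    by exists (sigma e); rewrite Gsigma_e; split=> //; exact: img_closure.
  exists 1%N => l; have [m [f [P [homP PE]]]] := homog_form1 (l \o G)%VF.
  by exists m, f, P; split=> // u; rewrite -[RHS]PE [RHS]comp_lfunE.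
- split; first by exists e; rewrite Gsigma_e.
  move=> x _ _; rewrite Gsigma => hx; apply: vlineZ.
  by apply: contraNneq hx => ->; rewrite scale0r.
- split.
    by exists (sigma e); rewrite Gsigma_e; split=> //; exact: img_closure.
  move=> y Yy _; rewrite sigmaG // => hy; apply: vlineZ.
  by apply: contraNneq hy => ->; rewrite scale0r.
Qed.

End Congruence.

(** * The three conclusions together *)

Theorem normal_congruence (K : numClosedFieldType) (V : vectType K)
    (W : {vspace bilin V}) (sigma : ratmap V (subvs_of W))
    (s : 'Hom(dual (subvs_of W), subvs_of W))
    (sigma_qc : quadratic_congruence sigma s)
    (H : {vspace V}) (C : bilin (subvs_of H)) (normalW : normal_with W C)
    (phi : 'Hom(subvs_of W, dual (subvs_of W))) (phi_def : phi = (s^-1)%VF)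
    (phi_nanti : ~ antisymmetric_map phi) :
  [/\ (quad_rank C + 2)%N = quad_rank (Qform phi),
      forall (tau : ratmap V (subvs_of W))
             (tau_star : 'Hom(dual (subvs_of W), subvs_of W))
             (psi : 'Hom(subvs_of W, dual (subvs_of W))),
        quadratic_congruence tau tau_star ->
        psi = (tau_star^-1)%VF ->
        ~ antisymmetric_map psi ->
        exists k : K,
          k != 0 /\ sym_part_dual (psi^-1)%VF = k *: sym_part_dual (phi^-1)%VF
    & birational_between (@proj_space _ V)
        (zariski_closure (rat_image sigma)) sigma].
Proof.
have [F] := normal_frame_exists normalW.
subst phi; split.
- by rewrite (quad_rank_congruence F normalW sigma_qc).
- move=> tau t psi tau_qc -> psi_nanti.
  have [k kE] := congruence_polar F normalW sigma_qc.
  have [k' kE'] := congruence_polar F normalW tau_qc.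
  have k0 := congruence_polar_neq0 sigma_qc kE phi_nanti.
  have k0' := congruence_polar_neq0 tau_qc kE' psi_nanti.
  (* In a common frame both symmetric parts are multiples of the same D, by k/2 and k'/2 on
     [nf_polar]. *)
  exists (k' / k); split; first by rewrite mulf_neq0 ?invr_eq0.
  rewrite !lfun_invK; [|exact: qc_bij sigma_qc|exact: qc_bij tau_qc].
  apply/lfunP => l; apply/dual_ext => m.
  rewrite [in RHS]scale_lfunE [in RHS]linearZ.
  apply: etrans (sym_part_dualE _ _ _) _; rewrite kE'.
  rewrite -[RHS]/(k' / k * (m (sym_part_dual s l) : K)).
  by rewrite sym_part_dualE kE; field.
- exact (congruence_birational F normalW sigma_qc phi_nanti).
Qed.

Theorem proposition3p2p2 (R : realType) (n : nat) (n_ge3 : (3 <= n)%N)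
    (V : vectType R[i]) (dimV : \dim {:V} = n)
    (W : {vspace bilin V})
    (sigma : ratmap V (subvs_of W))
    (sigma_star : 'Hom(dual (subvs_of W), subvs_of W))
    (sigma_qc : quadratic_congruence sigma sigma_star)
    (H : {vspace V}) (C : bilin (subvs_of H))
    (sigma_normal : normal_with W C)
    (phi : 'Hom(subvs_of W, dual (subvs_of W)))
    (phi_def : phi = (sigma_star^-1)%VF)
    (phi_nanti : ~ antisymmetric_map phi)
    (r : nat) (r_def : r = quad_rank (Qform phi)) :
  [/\ (quad_rank C + 2)%N = r,
      forall (tau : ratmap V (subvs_of W))
             (tau_star : 'Hom(dual (subvs_of W), subvs_of W))
             (psi : 'Hom(subvs_of W, dual (subvs_of W))),
        quadratic_congruence tau tau_star ->
        psi = (tau_star^-1)%VF ->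
        ~ antisymmetric_map psi ->
        exists k : R[i],
          k != 0 /\ sym_part_dual (psi^-1)%VF = k *: sym_part_dual (phi^-1)%VF
    & birational_between (@proj_space _ V)
        (zariski_closure (rat_image sigma)) sigma].
Proof.
rewrite r_def.
exact (normal_congruence sigma_qc sigma_normal phi_def phi_nanti).
Qed.
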